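(* Let $\alpha\in\mathcal P$ be the partition associated with a strictly decreasing sequence $(t_n)_{n\ge1}\subseteq(0,1]$ with $t_1=1$ and $t_n\to0$, and put $a_n=t_n-t_{n+1}$. For every $\varepsilon\in\{0,1\}^{\mathbb N}$ and every $z\in(0,1]$, for Lebesgue almost every $x\in[0,1]$ the limit $$\lim_{N\to\infty}\frac{\#\{1\le n\le N:\theta_n^{\varepsilon}(x)<z\}}{N}$$ exists and equals $$F_\varepsilon(z)=\sum_{n\in N_1}a_n+\sum_{n\in N_2}t_{n+1-\varepsilon_n}z,\qquad N_1=\Big\{n:\tfrac{a_n}{t_{n+1-\varepsilon_n}}<z\Big\},\ N_2=\Big\{n:\tfrac{a_n}{t_{n+1-\varepsilon_n}}\ge z\Big\}.$$ Furthermore, with $M_\varepsilon=\int_0^1(1-F_\varepsilon(z))\,dz$, we have $M_{\bar0}>M_{\bar1}$ and $$\mathcal M=\bigcap_{n=0}^{\infty}\ \bigcup_{\omega\in\{0,1\}^n}[M_{\omega\bar1},M_{\omega\bar0}].$$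
   Context: A strictly decreasing sequence $(t_n)_{n\ge1}\subseteq(0,1]$ with $t_1=1$ and $\lim t_n=0$ determines the partition $\alpha=\{A_n=(t_{n+1},t_n]:n\in\mathbb N\}\cup\{A_\infty=\{0\}\}$ of $[0,1]$; $\mathcal P$ is the class of all such partitions, and $a_n=t_n-t_{n+1}$. For $\varepsilon=(\varepsilon_n)_{n\ge1}\in\{0,1\}^{\mathbb N}$ define $T_\varepsilon:[0,1]\to[0,1]$ by $T_\varepsilon(0)=0$, $T_\varepsilon(x)=(x-t_{n+1})/a_n$ if $x\in A_n$ and $\varepsilon_n=0$, and $T_\varepsilon(x)=(t_n-x)/a_n$ if $x\in A_n$ and $\varepsilon_n=1$. Set $\varepsilon_\infty=0$. For $x\in[0,1]$ and $n\ge1$ let $d_n=d_n(x)=k$ and $s_n=s_n(x)=\varepsilon_k$ where $T_\varepsilon^{n-1}(x)\in A_k$. Define the $n$-th approximation $\frac{p_n}{q_n}=\sum_{k=1}^n(-1)^{\sum_{i=1}^{k-1}s_i}\,t_{d_k+1-s_k}\prod_{i=1}^{k-1}a_{d_i}$ with $q_n=\big(t_{d_n+1-s_n}\prod_{i=1}^{n-1}a_{d_i}\big)^{-1}$ (empty sums are $0$, empty products $1$), and the approximation coefficients $\theta_n^\varepsilon(x)=q_n\,|x-p_n/q_n|$. For a finite word $\omega$ over $\{0,1\}$ and $\varepsilon\in\{0,1\}^{\mathbb N}$, $\omega\varepsilon$ denotes concatenation; $\bar0,\bar1$ are the constant sequences of $0$'s and $1$'s. $\mathcal M=\{M_\varepsilon:\varepsilon\in\{0,1\}^{\mathbb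 N}\}$. *)

(* Defs.v *)
From HB Require Import structures.
From mathcomp Require Import all_boot all_order all_algebra.
From mathcomp Require Import all_classical all_reals all_analysis.

Set Implicit Arguments.
Unset Strict Implicit.
Unset Printing Implicit Defensive.

Import Order.TTheory GRing.Theory Num.Theory.
Import numFieldNormedType.Exports.

Local Open Scope classical_set_scope.
Local Open Scope ring_scope.

(* Indexing.  The sequences (t_n), (a_n), (eps_n), (A_n) of the mathematics
   start at n = 1; here they start at 0, so that [t n] is t_{n+1}, [e n] is
   eps_{n+1} and [Some n] is the digit n+1.  All indices shift together, so the
   formulas keep their shape, e.g. t_{n+1-eps_n} is [t (n.+1 - e n)].
   The position n >= 1 in an expansion (in d_n, s_n, p_n/q_n, q_n, theta_n) is
   not shifted. *)

Section AlternatingLuroth.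
Context {R : realType}.
Implicit Types (t : nat -> R) (e : nat -> bool) (k : option nat) (x z : R).

Definition is_partition_seq t : Prop :=
  [/\ forall n, 0 < t n <= 1,
      t 0%N = 1,
      forall n, t n.+1 < t n
    & t n @[n --> \oo] --> (0 : R)].

Definition gap t (n : nat) : R := t n - t n.+1.

(* Digits live in N with infinity added, the latter being [None]. *)
Definition cell t k : set R :=
  if k is Some n then `]t n.+1, t n]%classic else [set 0].

(* The k such that x lies in A_k; the cells partition [0,1], and only
   x in [0,1] matters. *)
Definition digit t x : option nat := xget None [set k | cell t k x].

Definition luroth_map t e x : R :=
  if digit t x is Some n then
    if e n then (t n - x) / gap t n else (x - t n.+1) / gap t n
  else 0.

Definition dig t e (n : nat) x : option nat :=
  digit t (iter n.-1 (luroth_map t e) x).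

(* eps_k, with eps_infty = 0 *)
Definition eps_at e k : bool := if k is Some n then e n else false.

Definition sgn_dig t e (n : nat) x : bool := eps_at e (dig t e n x).

(* a_k and t_{k+1-eps_k}; at k = infinity both take their limit value 0.
   The digit infinity occurs only for the countably many x whose orbit
   reaches 0. *)
Definition gap_at t k : R := if k is Some n then gap t n else 0.

Definition base_at t e k : R :=
  if k is Some n then t (n.+1 - e n)%N else 0.

Definition approx t e (n : nat) x : R :=
  \sum_(1 <= k < n.+1)
     (-1) ^+ (\sum_(1 <= i < k) sgn_dig t e i x)%N *
     base_at t e (dig t e k x) *
     \prod_(1 <= i < k) gap_at t (dig t e i x).

Definition approx_den t e (n : nat) x : R :=
  (base_at t e (dig t e n x) * \prod_(1 <= i < n) gap_at t (dig t e i x))^-1.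

Definition theta t e (n : nat) x : R :=
  approx_den t e n x * `|x - approx t e n x|.

Definition theta_count t e z (N : nat) x : nat :=
  count (fun n => theta t e n x < z) (iota 1 N).

Definition Fdist t e z : R :=
  \big[+%R/0]_(n <oo | gap t n / t (n.+1 - e n)%N < z) gap t n +
  \big[+%R/0]_(n <oo | z <= gap t n / t (n.+1 - e n)%N)
     (t (n.+1 - e n)%N * z).

Definition Mconst t e : R :=
  Rintegral lebesgue_measure `[0, 1]%classic (fun z => 1 - Fdist t e z).

End AlternatingLuroth.

Definition const_seq (b : bool) : nat -> bool := fun=> b.

Definition cat_word (n : nat) (w : n.-tuple bool) (e : nat -> bool) :
    nat -> bool :=
  fun i => if (i < n)%N then nth false w i else e (i - n)%N.

(* Main.v *)
Require Import Defs.
From HB Require Import structures.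
From mathcomp Require Import all_boot all_order all_algebra.
From mathcomp Require Import all_classical all_reals all_analysis.
From mathcomp Require Import measurable_realfun ring lra zify.

Set Implicit Arguments.
Unset Strict Implicit.
Unset Printing Implicit Defensive.

Import Order.TTheory GRing.Theory Num.Theory.
Import numFieldNormedType.Exports.

Local Open Scope classical_set_scope.
Local Open Scope ring_scope.

(** Writing [d] for the digit of [y] and [T] for the Lueroth map, the [n]-th
    approximation coefficient of [x] equals [a_d / t_(d+1-eps_d) * T y] at
    [y = T^(n-1) x]; so the frequency in question is that of visits of the orbit
    to a fixed set [G], whose trace on each cell [A_k] is [{y : T y < c_k}].
    As [T] is affine and onto on every cell, it preserves Lebesgue measure and the
    correlations of an initial interval with the future decay like [rho ^ n],
    with [rho < 1] bounding the [a_k].  The visits to [G] are therefore weakly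
    correlated, their centered sums have second moment O(N), and the strong law
    follows by convergence along squares.

    The measure of [G] is [F(z) = sum_k min(a_k, t_(k+1-eps_k) z)], which is
    monotone in each [eps_k] and changes by at most [t_n] when [eps] is altered
    from index [n] on.  So [M_eps] is antitone and continuous in [eps], the
    interval of a word shrinks to a point as the word grows, and Koenig's lemma
    turns words of every length whose interval contains [x] into an infinite one. *)

(** * Lebesgue measure on the unit interval *)

Section UnitIntervalMeasure.
Context {R : realType}.
Implicit Types A B C D : set R.
Local Notation leb := (@lebesgue_measure R).

Lemma measurable_affine (a c : R) : measurable_fun [set: R] (fun x => (x - c) / a).
Proof. by apply: measurable_funM => //; exact: measurable_funB. Qed.

(** Uniqueness of Lebesgue measure: the pushforward under the affine map, rescaled by [a^-1], gives
    half-open intervals their length. *)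
Lemma lebesgue_measure_affine (a c : R) B : 0 < a -> measurable B ->
  leb ((fun x => (x - c) / a) @^-1` B) = (a%:E * leb B)%E.
Proof.
move=> a0 mB.
pose f := (fun x : measurableTypeR R => (x - c) / a) : _ -> measurableTypeR R.
have mf : measurable_fun setT f by exact: measurable_affine.
have ai0 : 0 <= a^-1 by rewrite invr_ge0 ltW.
pose nu := mscale (NngNum ai0) (pushforward leb f).
have -> : leb B = nu mf B.
  apply: lebesgue_measure_unique => //= _ [[u v]] _ <-.
  rewrite /nu /mscale/= /pushforward.
  have -> : f @^-1` `]u, v]%classic = `](a * u + c), (a * v + c)]%classic.
    apply/seteqP; split => x /=; rewrite !in_itv/= /f ltr_pdivlMr// ler_pdivrMr//.
      by move=> /andP[? ?]; apply/andP; split; lra.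
    by move=> /andP[? ?]; apply/andP; split; lra.
  rewrite !lebesgue_measure_itv/= !lte_fin ltrD2r ltr_pM2l//.
  case: ifPn => _; last by rewrite mule0.
  rewrite -!EFinD -EFinM; congr EFin; field; exact: lt0r_neq0.
by rewrite /nu /mscale/= muleA -EFinM mulfV ?lt0r_neq0// mul1e.
Qed.

Lemma lebesgue_measure_affineN (a c : R) B : 0 < a -> measurable B ->
  leb ((fun x => (c - x) / a) @^-1` B) = (a%:E * leb B)%E.
Proof.
move=> a0 mB.
have mNB : measurable (-%R @^-1` B : set R).
  by rewrite -[X in measurable X]setTI; exact: oppr_measurable.
rewrite -[leb B]lebesgue_measureN// -(@lebesgue_measure_affine a c)//.
congr (leb _); apply/funext => x /=; rewrite /preimage/=; congr (B _).
by rewrite -mulNr opprB.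
Qed.

(** Intersecting with [0, 1] inside the definition lets rays and full preimages under the map be
    measured directly, with real values. *)
Definition umeas B : R := fine (leb (`[0, 1]%classic `&` B)).

Lemma umeasE B : measurable B ->
  ((umeas B)%:E = leb (`[0%R, 1%R]%classic `&` B))%E.
Proof.
move=> mB; rewrite fineK// ge0_fin_numE//.
apply: (@le_lt_trans _ _ (leb `[0%R, 1%R]%classic)).
  by apply: le_measure; rewrite ?inE//; exact: measurableI.
by rewrite lebesgue_measure_itv/= lte_fin ltr01 ltry.
Qed.

Lemma umeas_ge0 B : 0 <= umeas B.
Proof. exact: fine_ge0. Qed.

Lemma umeas_le A B : measurable A -> measurable B ->
  `[0, 1] `&` A `<=` B -> umeas A <= umeas B.
Proof.
move=> mA mB AB; rewrite -lee_fin !umeasE//; apply: le_measure.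
- by rewrite inE; exact: measurableI.
- by rewrite inE; exact: measurableI.
- by move=> x [? ?]; split => //; exact: AB.
Qed.

Lemma eq_umeas A B : `[0, 1] `&` A = `[0, 1] `&` B -> umeas A = umeas B.
Proof. by rewrite /umeas => ->. Qed.

Lemma umeas_set0 : umeas set0 = 0.
Proof. by rewrite /umeas setI0 measure0. Qed.

Lemma umeasU A B : measurable A -> measurable B -> A `&` B = set0 ->
  umeas (A `|` B) = umeas A + umeas B.
Proof.
move=> mA mB AB; apply/EFin_inj; rewrite EFinD !umeasE//; last exact: measurableU.
rewrite setIUr measureU//; [exact: measurableI|exact: measurableI|].
by rewrite setIACA AB setI0.
Qed.

Lemma umeas_itvNyc (c : R) : 0 <= c <= 1 -> umeas `]-oo, c] = c.
Proof.
move=> /andP[c0 c1]; rewrite /umeas.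
have -> : `[0, 1] `&` `]-oo, c] = `[0, c]%classic :> set R.
  apply/seteqP; split => x /=; rewrite !in_itv/=.
    by move=> [/andP[-> _] ->].
  by move=> /andP[-> xc]; rewrite xc (le_trans xc).
rewrite lebesgue_measure_itv/= lte_fin oppr0 adde0.
by case: ltgtP c0 => // ->.
Qed.

Lemma umeas_set1 (c : R) : umeas [set c] = 0.
Proof.
rewrite /umeas (@subset_measure0 _ _ _ leb _ [set c])//.
- exact: measurableI.
- exact: lebesgue_measure_set1.
Qed.

Lemma umeas_itvNyo (c : R) : 0 <= c <= 1 -> umeas `]-oo, c[ = c.
Proof.
move=> c01; rewrite -[RHS]umeas_itvNyc//.
have -> : `]-oo, c]%classic = `]-oo, c[ `|` [set c] :> set R.
  by rewrite setUitv1.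
rewrite umeasU ?umeas_set1 ?addr0//.
by apply/seteqP; split => // x [/=]; rewrite in_itv/= => + xc; rewrite xc ltxx.
Qed.

(** Serves the decreasing branches, which turn an initial interval into a final one; the point [c]
    itself is null. *)
Lemma umeas_itvoy (c : R) B : measurable B ->
  umeas (`]c, +oo[ `&` B) = umeas B - umeas (`]-oo, c[ `&` B).
Proof.
move=> mB.
have H : umeas (`]-oo, c] `&` B) = umeas (`]-oo, c[ `&` B).
  have -> : `]-oo, c]%classic = `]-oo, c[ `|` [set c] :> set R by rewrite setUitv1.
  rewrite setIUl umeasU; [|exact: measurableI|exact: measurableI|].
    rewrite (_ : umeas ([set c] `&` B) = 0) ?addr0//.
    apply/eqP; rewrite eq_le umeas_ge0 andbT -(umeas_set1 c).
    by apply: umeas_le => //; [exact: measurableI|move=> x [_ []]].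
  rewrite setIACA (_ : _ `&` [set c] = set0) ?set0I//.
  by apply/seteqP; split => // x [/=]; rewrite in_itv/= => + xc; rewrite xc ltxx.
apply/eqP; rewrite eq_sym subr_eq -H -umeasU.
- rewrite -setIUl (_ : _ `|` _ = setT) ?setTI//.
  by apply/seteqP; split => // x _ /=; rewrite !in_itv/= andbT; case: ltP; [left|right].
- exact: measurableI.
- exact: measurableI.
- rewrite setIACA (_ : _ `&` `]-oo, c] = set0) ?set0I//.
  by apply/seteqP; split => // x [/=]; rewrite !in_itv/= andbT ltNge => /negP.
Qed.

Lemma umeas_setT : umeas setT = 1.
Proof.
rewrite -[RHS](@umeas_itvNyc 1) ?ler01 ?lexx//; apply: eq_umeas.
apply/seteqP; split => x /=; rewrite !in_itv/=; last by case.
by move=> [/andP[-> ->]].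
Qed.

Lemma umeas_le1 B : measurable B -> umeas B <= 1.
Proof. by move=> mB; rewrite -umeas_setT; exact: umeas_le. Qed.

(** The endpoints are null. Both kinds are needed because a branch maps its half-open cell onto ]0,
    1] or [0, 1[, depending on its orientation. *)
Lemma lebesgue_unit_itv (b0 b1 : bool) B : measurable B ->
  leb ([set` Interval (BSide b0 0) (BSide b1 1)] `&` B) =
  (umeas B)%:E.
Proof.
move=> mB; rewrite umeasE//; apply/eqP; rewrite eq_le; apply/andP; split.
  apply: le_measure; rewrite ?inE; [exact: measurableI|exact: measurableI|].
  apply: setSI; apply: subset_itv; rewrite bnd_simp; by case: b0; case: b1.
have -> : leb ([set` Interval (BSide b0 0) (BSide b1 1)] `&` B) =
    leb (([set` Interval (BSide b0 0) (BSide b1 1)] `&` B) `|` [set 0; 1]).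
  rewrite measureU0//; first exact: measurableI.
    exact: measurableU.
  apply: (@null_set_setU _ _ _ leb [set 0] [set 1]) => //;
    exact: lebesgue_measure_set1.
apply: le_measure; rewrite ?inE; [exact: measurableI| |].
  by apply: measurableU; [exact: measurableI|exact: measurableU].
move=> x [/=]; rewrite in_itv/= => /andP[]; rewrite !le_eqVlt.
case: eqVneq => [<-|_ /= x0]; first by move=> *; right; left.
case: eqVneq => [->|_ /= x1]; first by move=> *; right; right.
move=> Bx; left; split => //; rewrite in_itv/=.
by case: (b0); case: (b1); rewrite /= ?x0 ?x1 ?(ltW x0) ?(ltW x1).
Qed.

End UnitIntervalMeasure.

(** * The Lueroth map: cells, measurability, invariance of the measure *)

Section LurothMap.
Context {R : realType}.
Variables (t : nat -> R) (e : nat -> bool).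
Hypothesis ht : is_partition_seq t.
Implicit Types (x : R) (n : nat).

Local Notation T := (luroth_map t e).
Local Notation a := (gap t).

Let t_gt0 n : 0 < t n. Proof. by case: ht => /(_ n) /andP[]. Qed.
Let t_le1 n : t n <= 1. Proof. by case: ht => /(_ n) /andP[]. Qed.
Let t_cvg : t n @[n --> \oo] --> (0 : R). Proof. by case: ht. Qed.

Lemma partition_seq_le : {homo t : m n / (m <= n)%N >-> n <= m}.
Proof.
case: ht => _ _ tS _ m n; elim: n => [|n IH]; first by rewrite leqn0 => /eqP->.
by rewrite leq_eqVlt => /predU1P[->//|/IH]; apply: le_trans; exact/ltW.
Qed.

Lemma gap_gt0 n : 0 < a n.
Proof. by case: ht => _ _ tS _; rewrite subr_gt0. Qed.

Lemma partition_seq_small (r : R) : 0 < r -> exists n, t n < r.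
Proof.
move=> r0; have /cvgrPdist_lt/(_ _ r0)[n _ /(_ n (leqnn n))] := t_cvg.
by rewrite sub0r normrN gtr0_norm//; exists n.
Qed.

Lemma cell_exists x : 0 < x <= 1 -> exists n, cell t (Some n) x.
Proof.
case: ht => _ t0 _ _ /andP[x0 x1].
have [n tnx] := partition_seq_small x0.
elim: n tnx => [|n IH] tnx; first by move: tnx; rewrite t0 ltNge x1.
by case: (ltP (t n) x) => [/IH//|xtn]; exists n; rewrite /= in_itv/= tnx.
Qed.

Lemma cell_inj x (k l : option nat) : cell t k x -> cell t l x -> k = l.
Proof.
have lt m n : (m < n)%N -> cell t (Some m) x -> cell t (Some n) x -> False.
  move=> mn /=; rewrite !in_itv/= => /andP[mx _] /andP[_ xn].
  by have := partition_seq_le mn; rewrite leNgt (lt_le_trans mx).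
have nz m : cell t (Some m) x -> x = 0 -> False.
  by move=> /=; rewrite in_itv/= => /andP[+ _] x0; rewrite x0 ltNge ltW.
case: k => [k|] kx; case: l => [l|] lx //.
- by case: (ltngtP k l) => [/lt/(_ kx lx)|/lt/(_ lx kx)|->].
- by case: (nz _ kx).
- by case: (nz _ lx).
Qed.

Lemma digit_cell x k : cell t k x -> digit t x = k.
Proof.
move=> kx; rewrite /digit; apply: xget_unique => // l lx.
exact: cell_inj lx kx.
Qed.

Lemma digit_Some x n : digit t x = Some n -> cell t (Some n) x.
Proof. by rewrite /digit; case: xgetP => // k _ kx kn; rewrite kn in kx. Qed.

Lemma cell_digit x : 0 <= x <= 1 -> cell t (digit t x) x.
Proof.
move=> /andP[]; rewrite le_eqVlt => /predU1P[<- _|x0 x1].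
  by rewrite (@digit_cell _ None).
have [|n nx] := @cell_exists x; first by rewrite x0.
by rewrite (digit_cell nx).
Qed.

(** The affine formula of one cell extended to the whole line, so that the scaling lemmas apply to
    full preimages. *)
Definition branch n x : R := if e n then (t n - x) / a n else (x - t n.+1) / a n.

Lemma luroth_map_cell n x : cell t (Some n) x -> T x = branch n x.
Proof. by move=> /digit_cell nx; rewrite /luroth_map nx. Qed.

Lemma luroth_map_itv x : 0 <= T x <= 1.
Proof.
rewrite /luroth_map; case dx: digit => [n|]; last by rewrite lexx ler01.
have := digit_Some dx; rewrite /= in_itv/= => /andP[nx xn].
have an := gap_gt0 n; rewrite /gap in an *.
by case: (e n); rewrite divr_ge0 ?ler_pdivrMr//; lra.
Qed.

Lemma iter_luroth_map_itv n x : 0 <= x <= 1 -> 0 <= iter n T x <= 1.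
Proof. by case: n => //= n _; exact: luroth_map_itv. Qed.

Lemma measurable_branch n : measurable_fun [set: R] (branch n).
Proof.
rewrite /branch; case: (e n); last exact: measurable_affine.
by apply: measurable_funM => //; exact: measurable_funB.
Qed.

Lemma measurable_luroth_map : measurable_fun [set: R] T.
Proof.
pose U := \bigcup_n cell t (Some n).
have mc n : measurable (cell t (Some n)) by exact: measurable_itv.
have mU : measurable U by exact: bigcupT_measurable.
rewrite -(setUv U); apply/measurable_funU => //; first exact: measurableC.
split.
  apply/measurable_fun_bigcup => // n.
  apply: (eq_measurable_fun (branch n)).
    by move=> x /[!inE] /luroth_map_cell ->.
  exact: measurable_funTS (measurable_branch n).
(* Off the cells with finite index, outside [0, 1] included, the digit is [None] and the map is
   0. *)
apply: (eq_measurable_fun (fun=> 0 : R)) => // x /[!inE] Ux.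
rewrite /luroth_map; case dx: digit => [n|] //=.
by exfalso; apply: Ux; exists n => //; exact: digit_Some.
Qed.

Lemma measurable_iter_luroth_map n : measurable_fun [set: R] (iter n T).
Proof.
elim: n => [|n IH]; first exact: measurable_id.
rewrite (_ : iter n.+1 T = T \o iter n T)//.
exact: measurableT_comp measurable_luroth_map IH.
Qed.

Lemma measurable_preimage_luroth B : measurable B -> measurable (T @^-1` B).
Proof.
by move=> mB; rewrite -[X in measurable X]setTI; exact: measurable_luroth_map.
Qed.

Lemma measurable_preimage_iter n B : measurable B -> measurable (iter n T @^-1` B).
Proof.
by move=> mB; rewrite -[X in measurable X]setTI; exact: measurable_iter_luroth_map.
Qed.

Lemma measurable_cell k : measurable (cell t k).
Proof. by case: k => [n|]; [exact: measurable_itv|exact: measurable_set1]. Qed.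
Hint Resolve measurable_cell : core.

Lemma cell_sub n : cell t (Some n) `<=` `[0, 1].
Proof.
move=> x /=; rewrite !in_itv/= => /andP[nx xn].
by rewrite (le_trans xn)// (le_trans _ (ltW nx))// ltW.
Qed.

(** On the cell the map is an affine bijection onto the unit interval up to an endpoint, with slope
    of modulus [(a n)^-1]. *)
Lemma umeas_cell_preimage n B : measurable B ->
  umeas (T @^-1` B `&` cell t (Some n)) = a n * umeas B.
Proof.
move=> mB; have an := gap_gt0 n.
apply/EFin_inj; rewrite umeasE; last first.
  by apply: measurableI => //; exact: measurable_preimage_luroth.
rewrite EFinM.
rewrite -(@lebesgue_unit_itv _ (e n) (e n))//.
have mJ : measurable ([set` Interval (BSide (e n) (0:R)) (BSide (e n) 1)] `&` B).
  exact: measurableI.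
have -> : `[0, 1] `&` (T @^-1` B `&` cell t (Some n)) =
    branch n @^-1` ([set` Interval (BSide (e n) 0) (BSide (e n) 1)] `&` B).
  apply/seteqP; split => x.
    move=> [_ [TB nx]]; rewrite /preimage/= -(luroth_map_cell nx); split => //.
    rewrite (luroth_map_cell nx); move: nx; rewrite /branch /= !in_itv/=.
    rewrite /gap in an *; case: (e n) => /= /andP[h1 h2]; apply/andP; split;
      rewrite ?divr_ge0 ?divr_gt0 ?ltr_pdivrMr ?ler_pdivrMr//; lra.
  move=> [xJ xB].
  have nx : cell t (Some n) x.
    move: xJ; rewrite /branch /= !in_itv/=.
    rewrite /gap in an *; case: (e n) => /=;
      rewrite ?(ler_pdivlMr _ _ an) ?(ltr_pdivlMr _ _ an) ?ltr_pdivrMr ?ler_pdivrMr// mul0r =>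
      /andP[? ?]; lra.
  split; first exact: cell_sub nx.
  by split => //; rewrite /preimage /= (luroth_map_cell nx).
move: mJ; rewrite /branch.
by case: (e n) => mJ; [exact: lebesgue_measure_affineN|exact: lebesgue_measure_affine].
Qed.

(** Peeling off one cell at a time, with a remainder inside [0, [t n]], replaces countable
    additivity over the cells. *)
Lemma umeas_split_cell A n : measurable A ->
  umeas (A `&` `]-oo, t n]) =
  umeas (A `&` `]-oo, t n.+1]) + umeas (A `&` cell t (Some n)).
Proof.
move=> mA; rewrite -umeasU.
- congr umeas; rewrite -setIUr; congr (_ `&` _).
  apply/seteqP; split => x /=; rewrite !in_itv/=.
    by move=> ->; rewrite andbT; case: leP; [left|right].
  by move=> [/le_trans|/andP[]//]; apply; exact: partition_seq_le.
- exact: measurableI.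
- by apply: measurableI => //; exact: measurable_cell.
- rewrite setIACA; apply/seteqP; split => // x [_] /=; rewrite !in_itv/=.
  by move=> [+ /andP[+ _]]; rewrite leNgt => /negbTE ->.
Qed.

(* The two sides agree up to [t n] on [0, t n], and adding back the cells
   between [t n] and [t j] costs at most [t j * r]. *)
Lemma umeas_glue C D (s r : R) j : measurable C -> measurable D ->
  0 <= s <= 1 -> 0 <= r ->
  (forall k, (j <= k)%N ->
    `|umeas (C `&` cell t (Some k)) - s * umeas (D `&` cell t (Some k))| <= a k * r) ->
  `|umeas (C `&` `]-oo, t j]) - s * umeas (D `&` `]-oo, t j])| <= t j * r.
Proof.
move=> mC mD /andP[s0 s1] r0 H.
pose u n := umeas (C `&` `]-oo, t n]) - s * umeas (D `&` `]-oo, t n]).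
have ubnd n : `|u n| <= t n.
  have tn01 : 0 <= t n <= 1 by rewrite ltW/=.
  have bnd A : measurable A -> umeas (A `&` `]-oo, t n]) <= t n.
    move=> mA; rewrite -[leRHS]umeas_itvNyc//.
    by apply: umeas_le => //; [exact: measurableI|move=> x [_ []]].
  have C0 := bnd _ mC; have D0 := bnd _ mD.
  have C1 := umeas_ge0 (C `&` `]-oo, t n]).
  have D1 := umeas_ge0 (D `&` `]-oo, t n]).
  rewrite /u ler_norml; apply/andP; split; nra.
have ustep n : `|u j| <= `|u (j + n)%N| + (t j - t (j + n)%N) * r.
  elim: n => [|n IH]; first by rewrite addn0 subrr mul0r addr0.
  rewrite (le_trans IH)// addnS.
  have := H (j + n)%N (leq_addr _ _).
  set y := (X in `|X|) => yr.
  have -> : u (j + n)%N = u (j + n).+1 + y.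
    by rewrite /u /y !(@umeas_split_cell _ (j + n)%N)//; ring.
  have := ler_normD (u (j + n).+1) y; rewrite /gap in yr; lra.
have ule n : `|u j| <= t (j + n)%N + t j * r.
  rewrite (le_trans (ustep n))//; have := ubnd (j + n)%N.
  have := mulr_ge0 (ltW (t_gt0 (j + n)%N)) r0; lra.
rewrite leNgt; apply/negP => lt_u.
have /partition_seq_small[n tn] : 0 < `|u j| - t j * r by rewrite subr_gt0.
have := ule n; have := partition_seq_le (leq_addl j n); lra.
Qed.

Lemma itvNyt0 C : umeas (C `&` `]-oo, t 0%N]) = umeas C.
Proof.
case: ht => _ -> _ _; apply: eq_umeas; rewrite setIA.
apply/seteqP; split => x /=; rewrite !in_itv/=; first by case.
by move=> [x01 Cx]; split => //; case/andP: x01.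
Qed.

Lemma umeas_cell n : umeas (cell t (Some n)) = a n.
Proof.
have := @umeas_split_cell _ n measurableT; rewrite !setTI.
by rewrite !umeas_itvNyc ?t_le1 ?ltW ?t_gt0// /gap => ->; ring.
Qed.

Lemma umeas_preimage_init j B : measurable B ->
  umeas (T @^-1` B `&` `]-oo, t j]) = t j * umeas B.
Proof.
move=> mB; have mTB := measurable_preimage_luroth mB.
have B01 : 0 <= umeas B <= 1 by rewrite umeas_ge0 umeas_le1.
(* Gluing with error rate 0: the identity is exact on each cell, hence exact on [0, [t j]]. *)
have := @umeas_glue _ _ _ 0 j mTB measurableT B01 (lexx 0).
have tj : 0 <= t j <= 1 by rewrite ltW/=.
rewrite mulr0 setTI umeas_itvNyc// => H.
apply/eqP; rewrite -subr_eq0 -normr_le0 [X in _ - X]mulrC; apply: H => k _.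
by rewrite umeas_cell_preimage// setTI umeas_cell mulrC subrr normr0 mulr0.
Qed.

Lemma umeas_preimage B : measurable B -> umeas (T @^-1` B) = umeas B.
Proof.
move=> mB; rewrite -(itvNyt0 (T @^-1` B)) umeas_preimage_init//.
by case: ht => _ -> _ _; rewrite mul1r.
Qed.

Lemma iter_preimageS n (B : set R) : iter n.+1 T @^-1` B = T @^-1` (iter n T @^-1` B).
Proof. by apply/funext => x; rewrite /preimage/= -iterS iterSr. Qed.

Lemma umeas_preimage_iter n B : measurable B -> umeas (iter n T @^-1` B) = umeas B.
Proof.
move=> mB; elim: n => // n IH; rewrite iter_preimageS umeas_preimage//.
exact: measurable_preimage_iter.
Qed.

(** The first gap is [1 - t 1], and all later cells lie in ]0, [t 1]]; both lengths are below 1. *)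
Lemma gap_bounded : exists2 rho, 0 <= rho < 1 & forall n, a n <= rho.
Proof.
exists (Num.max (1 - t 1%N) (t 1%N)).
  have := gap_gt0 0; case: ht => _ t0 _ _; rewrite /gap t0 => h.
  by rewrite le_max gt_max (ltW (t_gt0 1)) orbT/=; have := t_gt0 1; lra.
case=> [|n]; rewrite le_max /gap; first by case: ht => _ -> _ _; rewrite lexx.
have := t_gt0 n.+2; have := @partition_seq_le 1 n.+1 isT => h1 h2.
by apply/orP; right; lra.
Qed.

End LurothMap.

(** * Decay of correlations and the set of points with small coefficient *)

Section Decorrelation.
Context {R : realType}.
Variables (t : nat -> R) (e : nat -> bool).
Hypothesis ht : is_partition_seq t.
Implicit Types (x y z : R) (n k : nat).

Local Notation T := (luroth_map t e).
Local Notation a := (gap t).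

Let t_gt0 n : 0 < t n. Proof. by case: ht => /(_ n) /andP[]. Qed.
Let t_le1 n : t n <= 1. Proof. by case: ht => /(_ n) /andP[]. Qed.
Let a_gt0 n : 0 < a n := gap_gt0 ht n.

Hint Resolve measurable_cell : core.

Lemma umeas_itvNyo_minr (c : R) : 0 <= c -> umeas `]-oo, c[ = Num.min 1 c.
Proof.
move=> c0; case: (leP 1 c) => c1; last by rewrite umeas_itvNyo// c0 ltW.
apply/eqP; rewrite eq_le umeas_le1//=.
rewrite -[leLHS](@umeas_itvNyo _ 1) ?ler01 ?lexx//; apply: umeas_le => // x [_] /=.
by rewrite !in_itv/= => /lt_le_trans; apply.
Qed.

(* Splitting off the cell of [c], the part below it is exactly independent
   of the future, and the part inside it is a rescaled interval seen one step
   later; so one application of the map gains a factor [gap t k <= rho]. *)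
Lemma umeas_itv_preimage_iter rho n (c : R) B :
  0 <= rho -> (forall k, a k <= rho) -> measurable B ->
  `|umeas (`]-oo, c[ `&` iter n T @^-1` B) - umeas `]-oo, c[ * umeas B| <= rho ^+ n.
Proof.
move=> rho0 arho mB; elim: n c => [|n IH] c.
  have mX : measurable (`]-oo, c[ `&` iter 0 T @^-1` B) by exact: measurableI.
  have := umeas_ge0 (`]-oo, c[ `&` iter 0 T @^-1` B); have := umeas_le1 mX.
  have := @umeas_ge0 R `]-oo, c[; have := umeas_le1 (measurable_itv `]-oo, c[).
  have := umeas_ge0 B; have := umeas_le1 mB.
  by rewrite expr0 ler_norml => *; apply/andP; split; nra.
rewrite iter_preimageS; set C := iter n T @^-1` B.
have mC : measurable C by exact: measurable_preimage_iter.
have mTC : measurable (T @^-1` C) by exact: measurable_preimage_luroth.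
have uC : umeas C = umeas B by exact: umeas_preimage_iter.
(* For [c] outside ]0, 1] the interval has measure 0 or 1, and independence is exact. *)
have [c0|c0] := leP c 0.
  have u0 : umeas `]-oo, c[ = 0.
    rewrite -[RHS](@umeas_set0 R); apply: eq_umeas; apply/seteqP; split => x [] //=.
    by rewrite !in_itv/= => /andP[x0 _] /lt_le_trans/(_ c0); rewrite ltNge x0.
  have -> : umeas (`]-oo, c[ `&` T @^-1` C) = 0.
    apply/eqP; rewrite eq_le umeas_ge0 andbT -u0.
    by apply: umeas_le => //; [exact: measurableI|move=> x [_ []]].
  by rewrite u0 mul0r subrr normr0 exprn_ge0.
have [c1|c1] := leP c 1; last first.
  rewrite umeas_itvNyo_minr ?(ltW c0)// min_l ?(ltW c1)// mul1r.
  have -> : umeas (`]-oo, c[ `&` T @^-1` C) = umeas (T @^-1` C).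
    apply: eq_umeas; apply/seteqP; split => x [x01 xC]; split => //; first by case: xC.
    by split => //; move: x01; rewrite /= !in_itv/= => /andP[_ /le_lt_trans]; apply.
  by rewrite umeas_preimage// uC subrr normr0 exprn_ge0.
rewrite umeas_itvNyo ?(ltW c0)//.
have [k ck] := cell_exists ht (introT andP (conj c0 c1)).
move: (ck) => /=; rewrite in_itv/= => /andP[kc kc'].
have -> : umeas (`]-oo, c[ `&` T @^-1` C) =
    umeas (T @^-1` C `&` `]-oo, t k.+1]) + umeas (T @^-1` C `&` `]t k.+1, c[).
  rewrite -umeasU.
  - congr umeas; rewrite -setIUr setIC; congr (_ `&` _).
    apply/seteqP; split => x /=; rewrite !in_itv/=.
      by move=> ->; rewrite andbT; case: leP; [left|right].
    by move=> [/le_lt_trans|/andP[]//]; apply.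
  - exact: measurableI.
  - exact: measurableI.
  - rewrite setIACA; apply/seteqP; split => // x [_] /=; rewrite !in_itv/=.
    by move=> [+ /andP[+ _]]; rewrite leNgt => /negbTE ->.
rewrite umeas_preimage_init//.
(* [c'] is the image of [c] under the branch of its cell; pulling back through that branch
   multiplies measures by [a k]. *)
suff [c' c'E] : exists c', `|umeas (T @^-1` C `&` `]t k.+1, c[) - (c - t k.+1) * umeas B| =
    `|a k * (umeas (`]-oo, c'[ `&` C) - umeas `]-oo, c'[ * umeas B)|.
  rewrite uC (_ : _ - _ = umeas (T @^-1` C `&` `]t k.+1, c[) - (c - t k.+1) * umeas B); last ring.
  by rewrite c'E normrM (gtr0_norm (a_gt0 k)) exprS ler_pM// ltW.
have aE : a k = t k - t k.+1 by [].
have ak := a_gt0 k.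
(* On a decreasing branch the points below [c] go above [c']; passing to the complement only flips
   the sign of the correlation. *)
case ek : (e k).
  exists ((t k - c) / a k); rewrite umeas_itvNyo; last first.
    by rewrite divr_ge0 ?ler_pdivrMr//; lra.
  have -> : T @^-1` C `&` `]t k.+1, c[ =
      T @^-1` (`](t k - c) / a k, +oo[ `&` C) `&` cell t (Some k).
    apply/seteqP; split => x.
      move=> [xC] /=; rewrite in_itv/= => /andP[kx xc].
      have kx' : cell t (Some k) x by rewrite /= in_itv/= kx (le_trans (ltW xc)).
      split => //; split => //=; rewrite in_itv/= (luroth_map_cell _ ht kx') /branch ek.
      by rewrite andbT ltr_pM2r ?invr_gt0//; lra.
    move=> [[/=]]; rewrite in_itv/= andbT => + xC kx.
    rewrite (luroth_map_cell _ ht kx) /branch ek ltr_pM2r ?invr_gt0// => xc; split.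
      by move: xC; rewrite (luroth_map_cell _ ht kx) /branch ek.
    by move: kx; rewrite /= !in_itv/= => /andP[kx _]; apply/andP; split => //; lra.
  rewrite umeas_cell_preimage//; last exact: measurableI.
  rewrite umeas_itvoy// uC -normrN; congr `|_|; rewrite aE; field.
  by rewrite -aE; exact: lt0r_neq0.
exists ((c - t k.+1) / a k); rewrite umeas_itvNyo; last first.
  by rewrite divr_ge0 ?ler_pdivrMr//; lra.
have -> : T @^-1` C `&` `]t k.+1, c[ =
    T @^-1` (`]-oo, (c - t k.+1) / a k[ `&` C) `&` cell t (Some k).
  apply/seteqP; split => x.
    move=> [xC] /=; rewrite in_itv/= => /andP[kx xc].
    have kx' : cell t (Some k) x by rewrite /= in_itv/= kx (le_trans (ltW xc)).
    split => //; split => //=; rewrite in_itv/= (luroth_map_cell _ ht kx') /branch ek.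
    by rewrite ltr_pM2r ?invr_gt0//; lra.
  move=> [[/=]]; rewrite in_itv/= => + xC kx.
  rewrite (luroth_map_cell _ ht kx) /branch ek ltr_pM2r ?invr_gt0// => xc; split.
      by move: xC; rewrite (luroth_map_cell _ ht kx) /branch ek.
  by move: kx; rewrite /= !in_itv/= => /andP[kx _]; apply/andP; split => //; lra.
rewrite umeas_cell_preimage//; last exact: measurableI.
congr `|_|; rewrite aE; field.
by rewrite -aE; exact: lt0r_neq0.
Qed.

(** The approximation coefficient as a function of the current orbit point alone. At digit infinity
    it is 0, since [0 / 0] evaluates to 0. *)
Definition approx_coeff y : R :=
  gap_at t (digit t y) / base_at t e (digit t y) * T y.

Local Notation b n := (t (n.+1 - e n)%N).

Definition small_coeff z : set R := [set y | approx_coeff y < z].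

(** The digit is constant on a cell, so the bound on the coefficient becomes a bound on [T y]
    alone. *)
Lemma small_coeff_cell z k :
  small_coeff z `&` cell t (Some k) = T @^-1` `]-oo, z * b k / a k[ `&` cell t (Some k).
Proof.
have E y : cell t (Some k) y -> small_coeff z y = (T y \in `]-oo, z * b k / a k[) :> Prop.
  move=> yk; rewrite /small_coeff /= /approx_coeff in_itv/= (digit_cell ht yk)/=.
  by rewrite ltr_pdivlMr// mulrAC ltr_pdivrMr ?t_gt0// (mulrC (T y)).
by apply/seteqP; split => y [+ yk]; [rewrite E|rewrite /preimage /= -E].
Qed.

(** Points without a finite digit have coefficient 0, so [0 < z] puts all of them into the set; the
    rest is a countable union over cells. *)
Lemma measurable_small_coeff z : 0 < z -> measurable (small_coeff z).
Proof.
move=> z0; pose U := \bigcup_n cell t (Some n).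
have mU : measurable U by apply: bigcupT_measurable => n; exact: measurable_cell.
have -> : small_coeff z =
    \bigcup_n (T @^-1` `]-oo, z * b n / a n[ `&` cell t (Some n)) `|` ~` U.
  apply/seteqP; split => y.
    move=> yz; have [[n _ yn]|nU] := pselect (U y); last by right.
    by left; exists n => //; rewrite -small_coeff_cell.
  move=> [[n _]|nU]; first by rewrite -small_coeff_cell => -[].
  rewrite /small_coeff/= /approx_coeff; case dy: digit => [n|]; last by rewrite !mul0r.
  by exfalso; apply: nU; exists n => //; exact: digit_Some.
apply: measurableU; last exact: measurableC.
apply: bigcupT_measurable => n; apply: measurableI; last exact: measurable_cell.
exact: measurable_preimage_luroth.
Qed.

Lemma umeas_small_coeff_cell z k : 0 < z ->
  umeas (small_coeff z `&` cell t (Some k)) = Num.min (a k) (b k * z).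
Proof.
move=> z0; rewrite small_coeff_cell umeas_cell_preimage// umeas_itvNyo_minr; last first.
  by rewrite divr_ge0 ?ltW ?mulr_gt0.
rewrite minr_pMr ?ltW// mulr1; congr (Num.min _ _); field; exact: lt0r_neq0.
Qed.

Lemma umeas_small_coeff_sum z n : 0 < z ->
  `|umeas (small_coeff z) - \sum_(0 <= k < n) Num.min (a k) (b k * z)| <= t n.
Proof.
move=> z0; have mG := measurable_small_coeff z0.
have -> : umeas (small_coeff z) - \sum_(0 <= k < n) Num.min (a k) (b k * z) =
    umeas (small_coeff z `&` `]-oo, t n]).
  elim: n => [|n IH]; first by rewrite big_nil subr0 itvNyt0.
  by rewrite big_nat_recr//= opprD addrA IH (umeas_split_cell ht)// umeas_small_coeff_cell// addrK.
rewrite ger0_norm ?umeas_ge0// -[leRHS]umeas_itvNyc; last by rewrite ltW/=.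
by apply: umeas_le => //; [exact: measurableI|move=> x [_ []]].
Qed.

(** On each cell the set is the preimage of an initial interval, so one step of the map leaves the
    interval estimate with [n] steps, scaled by [a k]. Gluing from index 0 adds these errors up to
    [rho ^+ n]. *)
Lemma small_coeff_decorrelation rho z n :
  0 <= rho -> (forall k, a k <= rho) -> 0 < z ->
  `|umeas (small_coeff z `&` iter n.+1 T @^-1` small_coeff z) - umeas (small_coeff z) ^+ 2|
    <= rho ^+ n.
Proof.
move=> rho0 arho z0; have mG := measurable_small_coeff z0.
set G := small_coeff z.
have mGn : measurable (iter n.+1 T @^-1` G) by exact: measurable_preimage_iter.
have := @umeas_glue _ _ ht (G `&` iter n.+1 T @^-1` G) G (umeas G) (rho ^+ n) 0.
rewrite !(itvNyt0 ht) expr2 umeas_ge0 umeas_le1// exprn_ge0//.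
have -> : t 0%N = 1 by case: ht.
rewrite mul1r; apply => // [|k _]; first exact: measurableI.
rewrite iter_preimageS setIAC small_coeff_cell setIAC.
set c := z * b k / a k.
have mc : measurable (`]-oo, c[ `&` iter n T @^-1` G).
  by apply: measurableI => //; exact: measurable_preimage_iter.
rewrite -preimage_setI !umeas_cell_preimage// mulrCA -mulrBr normrM gtr0_norm// ler_pM2l//.
by rewrite (mulrC (umeas G)); exact: umeas_itv_preimage_iter.
Qed.

End Decorrelation.

(** * A strong law from second moments of order N *)

Section StrongLaw.
Context {R : realType}.
Implicit Types (f g : R -> R) (s : nat -> R).
Local Notation leb := (@lebesgue_measure R).
Local Notation I01 := (`[0%R, 1%R]%classic : set R).

Lemma square_interval (n : nat) : exists k, (k ^ 2 <= n < k.+1 ^ 2)%N.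
Proof.
elim: n => [|n [k /andP[kn nk]]]; first by exists 0%N.
have [nk'|nk'] := ltnP n.+1 (k.+1 ^ 2); first by exists k; rewrite nk' ltnW.
exists k.+1; rewrite nk' (leq_ltn_trans nk)// ltn_exp2r//.
Qed.

(* Between consecutive squares the sequence moves by at most 2k, which is
   negligible against k^2. *)
Lemma cvg_mean_squares s : s 0%N = 0 -> (forall n, `|s n.+1 - s n| <= 1) ->
  (s (n.+1 ^ 2)%N / (n.+1 ^ 2)%:R) ^+ 2 @[n --> \oo] --> (0 : R) ->
  s n / n%:R @[n --> \oo] --> (0 : R).
Proof.
move=> s0 s1 sq0.
have slip m n : `|s (m + n)%N - s m| <= n%:R.
  elim: n => [|n IH]; first by rewrite addn0 subrr normr0.
  rewrite addnS -natr1 (_ : _ - _ = (s (m + n).+1 - s (m + n)%N) + (s (m + n)%N - s m)); last ring.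
  by rewrite (le_trans (ler_normD _ _))// addrC lerD.
apply/cvgrPdist_le => eps eps0.
have eps2 : 0 < (eps / 2) ^+ 2 by rewrite exprn_gt0// divr_gt0.
have /cvgrPdist_le/(_ _ eps2)[K _ HK] := sq0.
(* Half of [eps] is spent on the value at the square, half on the slip: [2 * k.+1] is at most
   [eps / 2 * k.+1 ^ 2] once [4 / eps <= k.+1]. *)
have [L HL] : exists L : nat, 4 / eps <= L%:R.
  by exists (Num.truncn (4 / eps)).+1; exact/ltW/truncnS_gt.
exists ((maxn K L).+2 ^ 2)%N => // n /= nKL.
have [k /andP[kn nk]] := square_interval n.
have : ((maxn K L).+2 < k.+1)%N.
  by rewrite -(@ltn_exp2r _ _ 2)// (leq_ltn_trans nKL).
(* The root is positive; writing it as [k.+1] matches the sampling at [n.+1 ^ 2]. *)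
case: k kn nk => // k kn nk; rewrite !ltnS gtn_max => /andP[Kk Lk].
have kE : ((k.+1%:R) ^+ 2 : R) = (k.+1 ^ 2)%:R by rewrite natrX.
have k0 : 0 < (k.+1%:R : R) by rewrite ltr0n.
have eLk : 4 <= eps * k.+1%:R.
  rewrite mulrC -ler_pdivrMr// (le_trans HL)// ler_nat ltnW// ltnW//.
have := HK _ (ltnW Kk); rewrite sub0r normrN -kE.
rewrite normrX ler_pXn2r ?nnegrE ?divr_ge0 ?(ltW eps0)//.
rewrite normf_div [X in _ / X]ger0_norm ?exprn_ge0 ?ler0n// ler_pdivrMr ?exprn_gt0// kE => sk.
have mk : (n - k.+1 ^ 2 <= 2 * k.+1)%N by rewrite leq_subLR; lia.
have := slip (k.+1 ^ 2)%N (n - k.+1 ^ 2)%N; rewrite subnKC// => sn.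
have mkR : (n - k.+1 ^ 2)%:R <= 2 * k.+1%:R :> R by rewrite -natrM ler_nat.
have knR : (k.+1 ^ 2)%:R <= n%:R :> R by rewrite ler_nat.
have n0 : 0 < n%:R :> R by rewrite (lt_le_trans _ knR)// ltr0n.
rewrite sub0r normrN normf_div [X in _ / X]ger0_norm ?ler0n// ler_pdivrMr//.
have := ler_normD (s n - s (k.+1 ^ 2)%N) (s (k.+1 ^ 2)%N); rewrite subrK => tri.
rewrite -kE in sk knR; nra.
Qed.

(** Telescoping comparison of [1 / (m + 1) ^ 2] with [1 / m - 1 / (m + 1)]; the term [n%:R^-1]
    carries the induction and is 0 at [n = 0]. *)
Lemma sum_inv_squares n : \sum_(0 <= i < n) ((i.+1%:R : R) ^+ 2)^-1 <= 2 - n%:R^-1.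
Proof.
elim: n => [|[|n] IH]; first by rewrite big_nil invr0 subr0.
  by rewrite big_nat1 expr1n invr1; lra.
rewrite big_nat_recr//= (le_trans (lerD IH (lexx _)))//.
rewrite -[n.+2%:R]natr1; set m : R := n.+1%:R.
have m0 : 0 < m by rewrite ltr0n.
rewrite -subr_ge0 (_ : _ - _ = (m * (m + 1) ^+ 2)^-1).
  by rewrite invr_ge0 mulr_ge0 ?exprn_ge0//; lra.
by field; apply/andP; split; apply: lt0r_neq0; lra.
Qed.

(** Along squares the means have second moment at most [c / n.+1 ^ 2], which is summable. So the
    series of their squares has a finite integral, is finite almost everywhere, and its terms tend
    to 0. *)
Lemma ae_cvg_mean (X : nat -> R -> R) (c : R) :
  (forall i, measurable_fun setT (X i)) -> (forall i x, `|X i x| <= 1) ->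
  (forall n, \int[leb]_(x in I01) (\sum_(0 <= i < n) X i x) ^+ 2 <= c * n%:R) ->
  {ae leb, forall x, 0 <= x <= 1 ->
    (\sum_(0 <= i < n) X i x) / n%:R @[n --> \oo] --> (0 : R)}.
Proof.
move=> mX X1 L2.
pose S n x := \sum_(0 <= i < n) X i x.
pose f n x := (S (n.+1 ^ 2)%N x / (n.+1 ^ 2)%:R) ^+ 2.
have mS n : measurable_fun setT (S n) by apply: measurable_sum => i; exact: mX.
have Sb n x : `|S n x| <= n%:R.
  rewrite (le_trans (ler_norm_sum _ _ _))// (le_trans (ler_sum _ (fun i _ => X1 i x)))//.
  by rewrite sumr_const_nat subn0.
have mf n : measurable_fun setT (f n).
  by apply: measurable_funX; apply: measurable_funM => //; exact: mS.
have mfE n : measurable_fun I01 (EFin \o f n).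
  by apply/measurable_EFinP; exact: measurable_funTS (mf n).
have f0 n x : 0 <= f n x by exact: sqr_ge0.
have I01fin : (leb I01 < +oo)%E by rewrite lebesgue_measure_itv/= lte_fin ltr01 ltry.
have intS n : leb.-integrable I01 (EFin \o (fun x => S n x ^+ 2)).
  apply: measurable_bounded_integrable => //.
    by apply: measurable_funTS; apply: measurable_funX; exact: mS.
  exists (n%:R ^+ 2); split; first exact: num_real.
  move=> M nM x _ /=; rewrite normrX (le_trans _ (ltW nM))//.
  by rewrite lerXn2r ?nnegrE.
have If n : (\int[leb]_(x in I01) (f n x)%:E <= (c / (n.+1%:R) ^+ 2)%:E)%E.
  have -> : f n = (fun x => ((n.+1 ^ 2)%:R ^+ 2)^-1 * S (n.+1 ^ 2)%N x ^+ 2).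
    by apply/funext => x; rewrite /f expr_div_n mulrC.
  under eq_integral do rewrite EFinM.
  rewrite integralZl//; last exact: intS.
  have := L2 (n.+1 ^ 2)%N; rewrite -lee_fin /Rintegral fineK; last first.
    by apply: integrable_fin_num => //; exact: intS.
  move=> /(lee_wpmul2l (x := (((n.+1 ^ 2)%:R ^+ 2)^-1)%:E)) /=.
  rewrite lee_fin invr_ge0 exprn_ge0// => /(_ isT) /le_trans; apply.
  rewrite -EFinM lee_fin natrX; set m : R := n.+1%:R.
  rewrite le_eqVlt; apply/orP; left; apply/eqP; field.
  by rewrite addrC natr1 pnatr_eq0.
have Isum : (\int[leb]_(x in I01) (\sum_(0 <= n <oo) (f n x)%:E) < +oo)%E.
  rewrite integral_nneseries//; last by move=> n x _; rewrite lee_fin.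
  apply: (@le_lt_trans _ _ (\sum_(0 <= n <oo) (c / (n.+1%:R) ^+ 2)%:E)%E).
    apply: lee_nneseries => n *; last exact: If.
    by apply: integral_ge0 => x _; rewrite lee_fin.
  (* The moment bound at [n = 1] forces the sign of [c]. *)
  have c0 : 0 <= c.
    have := L2 1%N; rewrite mulr1; apply: le_trans; apply: Rintegral_ge0 => x _.
    exact: sqr_ge0.
  apply: (@le_lt_trans _ _ (c * 2)%:E); last exact: ltry.
  apply: lime_le.
    by apply: is_cvg_nneseries => n *; rewrite lee_fin divr_ge0// exprn_ge0.
  apply: nearW => n; rewrite sumEFin lee_fin -mulr_sumr ler_wpM2l//.
  by rewrite (le_trans (sum_inv_squares n))// gerBl invr_ge0.
have mE : measurable_fun I01 (fun x => \sum_(0 <= n <oo) (f n x)%:E)%E.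
  apply: ge0_emeasurable_sum => [n x _ _|n _]; [by rewrite lee_fin|exact: mfE].
have int : leb.-integrable I01 (fun x => \sum_(0 <= n <oo) (f n x)%:E)%E.
  apply/integrableP; split => //; under eq_integral => x _.
    rewrite gee0_abs; last by apply: nneseries_ge0 => n *; rewrite lee_fin.
  over.
  exact: Isum.
apply: filterS (integrable_ae _ int) => // x xfin x01.
apply: cvg_mean_squares; first by rewrite big_nil.
  by move=> n; rewrite big_nat_recr//= addrAC subrr add0r.
apply: cvg_series_cvg_0; apply: nnseries_is_cvg => [i|]; first exact: f0.
rewrite -ge0_fin_numE; last by apply: nneseries_ge0 => n *; rewrite lee_fin sqr_ge0.
by apply: xfin; rewrite /= in_itv.
Qed.

End StrongLaw.

(** * Frequencies of equiprobable events with geometrically decaying correlations *)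

Section Frequencies.
Context {R : realType}.
Local Notation leb := (@lebesgue_measure R).
Local Notation I01 := (`[0%R, 1%R]%classic : set R).

Lemma bounded_integrable_unit (f : R -> R) (M : R) : measurable_fun setT f ->
  (forall x, `|f x| <= M) -> leb.-integrable I01 (EFin \o f).
Proof.
move=> mf fM.
have I01fin : (leb I01 < +oo)%E by rewrite lebesgue_measure_itv/= lte_fin ltr01 ltry.
apply: measurable_bounded_integrable => //; first exact: measurable_funTS.
exists M; split; first exact: num_real.
  by move=> K MK x _ /=; rewrite (le_trans (fM x))// ltW.
Qed.

Lemma Rintegral_indic_unit (A : set R) : measurable A ->
  \int[leb]_(x in I01) \1_A x = umeas A.
Proof. by move=> mA; rewrite /Rintegral integral_indic// setIC. Qed.

Lemma Rintegral_cst_unit (r : R) : \int[leb]_(x in I01) (cst r x) = r.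
Proof.
rewrite Rintegral_cst//=.
by rewrite lebesgue_measure_itv/= lte_fin ltr01/= oppr0 addr0 mulr1.
Qed.

Lemma sum_expr_le (rho : R) n : 0 <= rho < 1 ->
  \sum_(0 <= i < n) rho ^+ (n - i).-1 <= (1 - rho)^-1.
Proof.
move=> /andP[rho0 rho1].
have r1 : 0 < 1 - rho by rewrite subr_gt0.
elim: n => [|n IH]; first by rewrite big_nil invr_ge0 ltW.
rewrite big_nat_recr//= subSnn expr0.
(* Every earlier lag grows by one, which costs a factor [rho]; the bound [(1 - rho)^-1] is the fixed
   point of [s = rho * s + 1]. *)
have -> : \sum_(0 <= i < n) rho ^+ (n.+1 - i).-1 =
    rho * \sum_(0 <= i < n) rho ^+ (n - i).-1.
  rewrite mulr_sumr; apply: eq_big_nat => i /andP[_ ni].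
  by rewrite -exprS prednK ?subn_gt0// subSn//= ltnW.
have H := ler_wpM2l rho0 IH.
rewrite (le_trans (lerD H (lexx _)))//.
by rewrite le_eqVlt; apply/orP; left; apply/eqP; field; exact: lt0r_neq0.
Qed.

(** In the application [E i] says that the [i]-th iterate has a small coefficient. The exponent
    [(j - i).-1] reflects the one step spent on leaving the first cell. *)
Variables (E : nat -> set R) (p rho : R).
Hypothesis rho01 : 0 <= rho < 1.
Hypothesis mE : forall i, measurable (E i).
Hypothesis umeas_E : forall i, umeas (E i) = p.
Hypothesis decorrelated : forall i j, (i < j)%N ->
  `|umeas (E i `&` E j) - p ^+ 2| <= rho ^+ (j - i).-1.

Local Notation X i := (fun x : R => \1_(E i) x - p).

Let p01 : 0 <= p <= 1.
Proof. by rewrite -(umeas_E 0) umeas_ge0 umeas_le1. Qed.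

Let mX i : measurable_fun setT (X i).
Proof. by apply: measurable_funB => //; exact: measurable_indic. Qed.

Let X1 i x : `|X i x| <= 1.
Proof.
case/andP: p01 => p0 p1; rewrite indicE ler_norml.
by case: (_ \in _) => /=; apply/andP; split; lra.
Qed.

Let covariance_X i j :
  \int[leb]_(x in I01) (X i x * X j x) = umeas (E i `&` E j) - p ^+ 2.
Proof.
have mEE : measurable (E i `&` E j) by exact: measurableI.
have indic_int A : measurable A -> leb.-integrable I01 (EFin \o \1_A).
  move=> mA; apply: (@bounded_integrable_unit _ 1); first exact: measurable_indic.
  by move=> x; rewrite indicE; case: (_ \in _); rewrite ?normr1 ?normr0.
have indicp_int A : measurable A -> leb.-integrable I01 (EFin \o (fun x => p * \1_A x)).
  move=> mA; apply: (@bounded_integrable_unit _ `|p|).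
    by apply: measurable_funM => //; exact: measurable_indic.
  by move=> x; rewrite indicE normrM; case: (_ \in _); rewrite ?normr1 ?normr0 ?mulr1 ?mulr0.
have cst_int r : leb.-integrable I01 (EFin \o (cst r : R -> R)).
  exact: (@bounded_integrable_unit _ `|r|).
have -> : (fun x => X i x * X j x) =
    (fun x => ((\1_(E i `&` E j) x - p * \1_(E i) x) - p * \1_(E j) x) + cst (p ^+ 2) x).
  by apply/funext => x; rewrite indicI /=; ring.
have i1 := indic_int _ mEE; have i2 := indicp_int _ (mE i); have i3 := indicp_int _ (mE j).
have i12 : leb.-integrable I01 (EFin \o (fun x => \1_(E i `&` E j) x - p * \1_(E i) x)).
  exact: (integrableB _ i1 i2).
have i123 : leb.-integrable I01
    (EFin \o (fun x => (\1_(E i `&` E j) x - p * \1_(E i) x) - p * \1_(E j) x)).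
  exact: (integrableB _ i12 i3).
rewrite RintegralD// RintegralB// RintegralB//.
have Z A : measurable A -> \int[leb]_(x in I01) (p * \1_A x) = p * umeas A.
  by move=> mA; rewrite -Rintegral_indic_unit// RintegralZl//; exact: indic_int.
by rewrite !(Z _ (mE _)) !Rintegral_indic_unit// !umeas_E Rintegral_cst_unit; ring.
Qed.

(** Induction on [n]: the new square contributes [p - p ^ 2], at most 1, and the doubled cross term
    at most [2 / (1 - rho)] by the geometric sum over lags. *)
Let second_moment n :
  \int[leb]_(x in I01) (\sum_(0 <= i < n) X i x) ^+ 2 <= (1 + 2 / (1 - rho)) * n%:R.
Proof.
pose S n x := \sum_(0 <= i < n) X i x.
have mS m : measurable_fun setT (S m) by apply: measurable_sum => i; exact: mX.
have Sb m x : `|S m x| <= m%:R.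
  rewrite (le_trans (ler_norm_sum _ _ _))// (le_trans (ler_sum _ (fun i _ => X1 i x)))//.
  by rewrite sumr_const_nat subn0.
have XX_int i j : leb.-integrable I01 (EFin \o (fun x => X i x * X j x)).
  apply: (@bounded_integrable_unit _ 1); first by apply: measurable_funM; exact: mX.
  by move=> x; rewrite normrM -[leRHS]mulr1 ler_pM.
have SX_int m j : leb.-integrable I01 (EFin \o (fun x => S m x * X j x)).
  apply: (@bounded_integrable_unit _ m%:R).
    by apply: measurable_funM; [exact: mS|exact: mX].
  by move=> x; rewrite normrM -[leRHS]mulr1 ler_pM.
have SS_int m : leb.-integrable I01 (EFin \o (fun x => S m x ^+ 2)).
  apply: (@bounded_integrable_unit _ (m%:R ^+ 2)).
    by apply: measurable_funX; exact: mS.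
  by move=> x; rewrite normrX lerXn2r ?nnegrE.
have cross m j : \int[leb]_(x in I01) (S m x * X j x) =
    \sum_(0 <= i < m) (umeas (E i `&` E j) - p ^+ 2).
  elim: m => [|m IH].
    rewrite big_nil (_ : (fun x => _) = cst 0) ?Rintegral_cst_unit//.
    by apply/funext => x; rewrite /S big_nil mul0r.
  rewrite big_nat_recr//= -IH -covariance_X -RintegralD//.
  by apply: eq_Rintegral => x _; rewrite /S big_nat_recr//= mulrDl.
elim: n => [|n IH].
  rewrite mulr0 (_ : (fun x => _) = cst 0) ?Rintegral_cst_unit//.
  by apply/funext => x; rewrite big_nil expr0n.
have -> : \int[leb]_(x in I01) (\sum_(0 <= i < n.+1) X i x) ^+ 2 =
    \int[leb]_(x in I01) (S n x ^+ 2 + (2 * (S n x * X n x) + X n x * X n x)).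
  by apply: eq_Rintegral => x _; rewrite big_nat_recr//= /S; ring.
have SX2_int : leb.-integrable I01 (EFin \o (fun x => 2 * (S n x * X n x))).
  exact: (integrableZl _ 2 (SX_int n n)).
rewrite RintegralD//; last exact: (integrableD _ SX2_int (XX_int n n)).
rewrite RintegralD// RintegralZl// cross covariance_X setIid umeas_E.
have : \sum_(0 <= i < n) (umeas (E i `&` E n) - p ^+ 2) <= (1 - rho)^-1.
  rewrite (le_trans _ (sum_expr_le n rho01))// big_nat_cond [leRHS]big_nat_cond.
  apply: ler_sum => i /andP[/andP[_ ni] _].
  by rewrite (le_trans (ler_norm _))// decorrelated.
case/andP: p01 => p0 p1; rewrite -natr1.
move: IH; rewrite -/(S n); set I := Rintegral _ _ _; set J := \sum_(_ <= _ < _) _.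
set r := (1 - rho)^-1.
nra.
Qed.

Lemma ae_cvg_frequency : {ae leb, forall x, 0 <= x <= 1 ->
  (\sum_(0 <= i < n) \1_(E i) x) / n%:R @[n --> \oo] --> (p : R)}.
Proof.
have := ae_cvg_mean mX X1 second_moment; 
apply: filterS; first exact: (ae_filter_ringOfSetsType leb).
move=> x H /H {}H.
have {}H := cvgD H (cvg_cst p).
rewrite add0r in H; apply: cvg_trans; last exact: H.
apply: near_eq_cvg.
(* Adding [p] back to the centered mean gives the frequency only for [n > 0]; at 0 both quotients
   are 0. *)
exists 1%N => // n /= n0.
rewrite fctE sumrB sumr_const_nat subn0 mulrBl -[p *+ _]mulr_natr mulfK ?subrK//.
by rewrite pnatr_eq0 -lt0n.
Qed.

End Frequencies.

(** * From approximation coefficients to orbit visits; the limit distribution *)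

Section Approximation.
Context {R : realType}.
Variables (t : nat -> R) (e : nat -> bool).
Hypothesis ht : is_partition_seq t.
Implicit Types (x y z : R) (n k : nat).

Local Notation T := (luroth_map t e).
Local Notation a := (gap t).
Local Notation b n := (t (n.+1 - e n)%N).
Local Notation leb := (@lebesgue_measure R).

Let t_gt0 n : 0 < t n. Proof. by case: ht => /(_ n) /andP[]. Qed.
Let t_le1 n : t n <= 1. Proof. by case: ht => /(_ n) /andP[]. Qed.
Let a_gt0 n : 0 < a n := gap_gt0 ht n.

(** The affine branch solved for [y]; iterated, this one-digit step generates the alternating
    expansion and its remainder. *)
Lemma luroth_expansion y : 0 <= y <= 1 ->
  y = base_at t e (digit t y) +
      (-1) ^+ eps_at e (digit t y) * gap_at t (digit t y) * T y.
Proof.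
move=> /(cell_digit ht); case dy: digit => [n|] yn; last first.
  by rewrite /= in yn; rewrite /= mulr0 mul0r addr0 yn.
rewrite (luroth_map_cell _ ht yn) /branch /=; have := a_gt0 n; rewrite /gap => an.
by case: (e n); rewrite ?subSS ?subn0 ?expr1 ?expr0; field; exact: lt0r_neq0.
Qed.

(* [approx] alone denotes a measure-theoretic approximation once
   mathcomp-analysis is imported. *)
Lemma approx_error n x : 0 <= x <= 1 ->
  x - Defs.approx t e n x = (-1) ^+ (\sum_(1 <= i < n.+1) sgn_dig t e i x)%N *
    \prod_(1 <= i < n.+1) gap_at t (dig t e i x) * iter n T x.
Proof.
move=> x01; elim: n => [|n IH].
  by rewrite /Defs.approx !big_nil subr0 expr0 !mul1r.
rewrite /Defs.approx big_nat_recr//= opprD addrA -/(Defs.approx t e n x) IH.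
have yE := luroth_expansion (iter_luroth_map_itv e ht n x01).
rewrite [in RHS]big_nat_recr//= [\prod_(1 <= i < n.+2) _]big_nat_recr//= exprD.
rewrite {1}yE /sgn_dig /dig /=; ring.
Qed.

Lemma gap_at_ge0 (k : option nat) : 0 <= gap_at t k.
Proof. by case: k => [n|] //=; exact: ltW. Qed.

Lemma digit_None y : 0 <= y <= 1 -> digit t y = None -> y = 0.
Proof. by move=> /(cell_digit ht) + yN; rewrite yN. Qed.

Lemma luroth_map0 : T 0 = 0.
Proof. by rewrite /luroth_map (@digit_cell _ _ ht _ None). Qed.

(** A zero factor means that the digit infinity occurred, so the orbit reached 0, where it stays. *)
Lemma prod_gap_eq0 n x : 0 <= x <= 1 ->
  \prod_(1 <= i < n.+1) gap_at t (dig t e i x) = 0 -> iter n T x = 0.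
Proof.
move=> x01; elim: n => [|n IH].
  by rewrite big_nil => /eqP; rewrite oner_eq0.
rewrite big_nat_recr//= => /eqP; rewrite mulf_eq0 => /orP[/eqP/IH ->|].
  exact: luroth_map0.
rewrite /dig/=; case dy: digit => [k|] /=; first by rewrite gt_eqF.
by rewrite (digit_None (iter_luroth_map_itv e ht n x01) dy) luroth_map0.
Qed.

(** The remainder carries the same product of gaps as the denominator, apart from the last gap,
    which survives the cancellation. *)
Lemma theta_approx_coeff n x : 0 <= x <= 1 ->
  theta t e n.+1 x = approx_coeff t e (iter n T x).
Proof.
move=> x01; rewrite /theta approx_error// /approx_den /approx_coeff.
have /andP[Tn0 _] := iter_luroth_map_itv e ht n.+1 x01.
set P := \prod_(1 <= i < n.+1) _.
have P0 : 0 <= P by apply: prodr_ge0 => i _; exact: gap_at_ge0.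
rewrite [\prod_(1 <= i < n.+2) _]big_nat_recr//= -/P -mulrA normrM normrX normrN1 expr1n mul1r.
rewrite ger0_norm; last first.
  by apply: mulr_ge0; [apply: mulr_ge0 => //; exact: gap_at_ge0|exact: Tn0].
(* With a zero product the denominator is the inverse of 0, that is 0, and the orbit sits at 0: both
   sides vanish. *)
have [PE|Pneq0] := eqVneq P 0.
  rewrite PE mulr0 invr0 mul0r (prod_gap_eq0 x01 PE).
  by rewrite (@digit_cell _ _ ht _ None)//= !mul0r.
rewrite invfM /dig /=; set g := gap_at _ _; set bt := base_at _ _ _.
by rewrite -(mulrA bt^-1) -(mulrA P) mulKf// (mulrA bt^-1) (mulrC bt^-1).
Qed.

Lemma theta_count_small_coeff z N x : 0 <= x <= 1 ->
  (theta_count t e z N x)%:R =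
  \sum_(0 <= i < N) \1_(iter i T @^-1` small_coeff t e z) x :> R.
Proof.
move=> x01; rewrite /theta_count; elim: N => [|N IH]; first by rewrite big_nil.
rewrite big_nat_recr// -IH -(addn1 N) iotaD count_cat /= addn0 natrD add1n.
congr (_ + _); rewrite theta_approx_coeff// indicE; congr (nat_of_bool _)%:R.
by apply/idP/idP; rewrite inE.
Qed.

(** The two index sets of [Fdist] record which argument of the minimum is the smaller one. *)
Lemma cvg_sum_min z : 0 <= z ->
  \sum_(0 <= k < n) Num.min (a k) (b k * z) @[n --> \oo] --> Fdist t e z.
Proof.
move=> z0; rewrite /Fdist.
have suma n : \sum_(0 <= k < n) a k <= 1.
  rewrite /gap (@eq_bigr _ _ _ _ _ _ _ (fun k => - t k.+1 - - t k)).
    rewrite telescope_sumr// opprK; case: ht => _ -> _ _.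
    by rewrite gerDr oppr_le0 ltW.
  by move=> i _; rewrite opprK addrC.
have bz k : 0 <= b k * z by rewrite mulr_ge0// ltW.
(* Each partial series is nondecreasing and dominated by the sum of the gaps, which is at most 1. *)
have cvg_part (P : pred nat) (f : nat -> R) :
    (forall k, P k -> 0 <= f k <= a k) ->
    \sum_(k < n | P k) f k @[n --> \oo] --> \big[+%R/0]_(k <oo | P k) f k.
  move=> fa.
  have -> : (fun n => \sum_(k < n | P k) f k) = (fun n => \sum_(0 <= k < n | P k) f k).
    by apply/funext => n; rewrite big_mkord.
  apply: (@nondecreasing_is_cvgn _ (fun n => \sum_(0 <= k < n | P k) f k)).
    apply/nondecreasing_seqP => n; rewrite big_mkcond [leRHS]big_mkcond big_nat_recr//=.
    by rewrite lerDl; case: ifP => // /fa /andP[].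
  exists 1 => _ [n _ <-]; rewrite (le_trans _ (suma n))// big_mkcond.
  by apply: ler_sum => i _; case: ifP => [/fa/andP[]//|_]; exact: ltW.
have c1 := cvg_part (fun n => a n / b n < z) a.
have c2 := cvg_part (fun n => z <= a n / b n) (fun n => b n * z).
have H1 k : a k / b k < z -> 0 <= a k <= a k by rewrite lexx ltW.
have H2 k : z <= a k / b k -> 0 <= b k * z <= a k.
  by rewrite bz ler_pdivlMr// mulrC.
have H := cvgD (c1 H1) (c2 H2).
apply: cvg_trans; last exact: H.
apply: near_eq_cvg; apply: nearW => n.
apply/esym; rewrite fctE /= big_mkord [LHS](bigID (fun k : 'I_n => a k / b k < z)) /=.
congr (_ + _).
  apply: eq_bigr => k; rewrite ltr_pdivrMr// mulrC => h; rewrite min_l// ltW//.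
apply: eq_big => k; first by rewrite leNgt.
by rewrite -leNgt ler_pdivlMr// mulrC => h; rewrite min_r.
Qed.

Lemma umeas_small_coeff z : 0 < z -> umeas (small_coeff t e z) = Fdist t e z.
Proof.
move=> z0; rewrite -(cvg_lim _ (cvg_sum_min (ltW z0)))//; apply/esym/cvg_lim => //.
apply/cvgrPdist_le => eps eps0.
have [_ _ _ /cvgrPdist_le/(_ _ eps0)[N _ HN]] := ht.
exists N => // n /HN; rewrite sub0r normrN (ger0_norm (ltW (t_gt0 n))) => tn.
exact: le_trans (umeas_small_coeff_sum e ht n z0) tn.
Qed.

Lemma ae_cvg_theta_count z : 0 < z ->
  {ae leb, forall x, 0 <= x <= 1 ->
    (theta_count t e z N x)%:R / N%:R @[N --> \oo] --> Fdist t e z}.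
Proof.
move=> z0; have [rho rho01 arho] := gap_bounded ht.
have /andP[rho0 _] := rho01.
have mG := measurable_small_coeff e ht z0.
have mE i : measurable (iter i T @^-1` small_coeff t e z).
  exact: measurable_preimage_iter.
have uE i : umeas (iter i T @^-1` small_coeff t e z) = Fdist t e z.
  by rewrite umeas_preimage_iter// umeas_small_coeff.
have dec i j : (i < j)%N ->
    `|umeas (iter i T @^-1` small_coeff t e z `&` iter j T @^-1` small_coeff t e z)
      - Fdist t e z ^+ 2| <= rho ^+ (j - i).-1.
  (* Factoring out the first [i] iterates, invariance reduces the pair to times 0 and [j - i]. *)
  move=> ij; have -> : iter j T @^-1` small_coeff t e z =
      iter i T @^-1` (iter (j - i).-1.+1 T @^-1` small_coeff t e z).
    rewrite prednK ?subn_gt0//; apply/funext => x; rewrite /preimage/=.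
    by rewrite -iterD subnK// ltnW.
  rewrite -preimage_setI umeas_preimage_iter//; last first.
    by apply: measurableI => //; exact: measurable_preimage_iter.
  by rewrite -umeas_small_coeff//; exact: small_coeff_decorrelation.
have := ae_cvg_frequency rho01 mE uE dec.
apply: filterS; first exact: (ae_filter_ringOfSetsType leb).
move=> x H x01; under eq_fun do rewrite theta_count_small_coeff//.
exact: H.
Qed.

End Approximation.

(** * Monotonicity and continuity of the mean in the sign sequence, and the set of its values *)

Section MeanValue.
Context {R : realType}.
Variable t : nat -> R.
Hypothesis ht : is_partition_seq t.
Implicit Types (e : nat -> bool) (x z : R) (n k : nat).

Local Notation a := (gap t).
Local Notation b e n := (t (n.+1 - e n)%N).
Local Notation leb := (@lebesgue_measure R).
Local Notation I01 := (`[0%R, 1%R]%classic : set R).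

Let t_gt0 n : 0 < t n. Proof. by case: ht => /(_ n) /andP[]. Qed.
Let t_le1 n : t n <= 1. Proof. by case: ht => /(_ n) /andP[]. Qed.
Let a_gt0 n : 0 < a n := gap_gt0 ht n.

Lemma sum_gap m n : (m <= n)%N -> \sum_(m <= k < n) a k = t m - t n.
Proof.
move=> mn; rewrite /gap (@eq_bigr _ _ _ _ _ _ _ (fun k => - t k.+1 - - t k)).
  by rewrite telescope_sumr// opprK addrC.
by move=> i _; rewrite opprK addrC.
Qed.

(** Passes termwise comparisons to the limit; asking only for [0 < n] leaves a first term to split
    off when strictness is at stake. *)
Lemma le_FdistD e e' z (c : R) : 0 <= z ->
  (forall n, (0 < n)%N -> \sum_(0 <= k < n) Num.min (a k) (b e k * z) <=
                          \sum_(0 <= k < n) Num.min (a k) (b e' k * z) + c) ->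
  Fdist t e z <= Fdist t e' z + c.
Proof.
move=> z0 le_sum.
have H : \sum_(0 <= k < n) Num.min (a k) (b e' k * z) + c @[n --> \oo] -->
    Fdist t e' z + c.
  by apply: cvgD; [exact: cvg_sum_min|exact: cvg_cst].
by apply: (ler_cvg_to (@cvg_sum_min _ _ e ht _ z0) H); exists 1%N.
Qed.

Lemma min_le_Fdist_term e e' z k : 0 <= z -> (e k -> e' k) ->
  Num.min (a k) (b e k * z) <= Num.min (a k) (b e' k * z).
Proof.
move=> z0 ee'; rewrite le_min ge_min lexx/= ge_min; apply/orP; right.
apply: ler_wpM2r => //; apply: (partition_seq_le ht); apply: leq_sub2l.
by case: (e k) ee' => // ->.
Qed.

Lemma Fdist_homo e e' z : 0 <= z -> (forall k, e k -> e' k) ->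
  Fdist t e z <= Fdist t e' z.
Proof.
move=> z0 ee'; rewrite -[leRHS]addr0; apply: le_FdistD => // n _; rewrite addr0.
by apply: ler_sum => k _; exact: (min_le_Fdist_term z0 (ee' k)).
Qed.

(** From index [n] on the terms lie between 0 and [a k], and these gaps sum to at most [t n]. *)
Lemma Fdist_agree e e' z n : 0 <= z -> (forall k, (k < n)%N -> e k = e' k) ->
  Fdist t e z <= Fdist t e' z + t n.
Proof.
move=> z0 ee'; apply: le_FdistD => // N _.
have agree m : (m <= n)%N ->
    \sum_(0 <= k < m) Num.min (a k) (b e k * z) = \sum_(0 <= k < m) Num.min (a k) (b e' k * z).
  move=> mn; apply: eq_big_nat => k /andP[_ km]; rewrite ee'//.
  exact: leq_trans km mn.
have [Nn|nN] := leqP N n; first by rewrite agree// lerDl (ltW (t_gt0 n)).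
rewrite !(@big_cat_nat _ _ _ n 0 N)//=; [|exact: ltnW|exact: ltnW].
rewrite agree// -addrA lerD2l.
apply: (@le_trans _ _ (\sum_(n <= k < N) a k)).
  by apply: ler_sum => k _; rewrite ge_min lexx.
rewrite sum_gap 1?ltnW// ler_wpDl ?gerBl ?(ltW (t_gt0 N))//.
by apply: sumr_ge0 => k _; rewrite le_min mulr_ge0 ?(ltW (a_gt0 k)) ?(ltW (t_gt0 _)).
Qed.

Lemma Fdist_bounds e z : 0 <= z -> 0 <= Fdist t e z <= 1.
Proof.
move=> z0; have cv := @cvg_sum_min _ _ e ht _ z0.
have t0 : t 0%N = 1 by case: ht.
apply/andP; split.
  apply: (cvgr_to_ge cv); apply: nearW => n.
  by apply: sumr_ge0 => k _; rewrite le_min mulr_ge0 ?(ltW (a_gt0 k)) ?(ltW (t_gt0 _)).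
apply: (cvgr_to_le cv); apply: nearW => n.
apply: (@le_trans _ _ (\sum_(0 <= k < n) a k)).
  by apply: ler_sum => k _; rewrite ge_min lexx.
by rewrite sum_gap// t0 gerBl (ltW (t_gt0 n)).
Qed.

Lemma measurable_Fdist e : measurable_fun I01 (Fdist t e).
Proof.
apply: (@measurable_fun_cvg _ _ _ _
  (fun n z => \sum_(0 <= k < n) Num.min (a k) (b e k * z))) => [n|z].
  apply: measurable_sum => k; apply: measurable_minr; first exact: measurable_cst.
  exact: mulrl_measurable.
by rewrite /= in_itv/= => /andP[z0 _]; exact: cvg_sum_min.
Qed.

Lemma integrable_1BFdist e (c : R) : leb.-integrable I01 (EFin \o (fun z => 1 - Fdist t e z + c)).
Proof.
have I01fin : (leb I01 < +oo)%E by rewrite lebesgue_measure_itv/= lte_fin ltr01 ltry.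
apply: measurable_bounded_integrable => //.
  by apply: measurable_funD => //; apply: measurable_funB => //; exact: measurable_Fdist.
exists (1 + `|c|); split; first exact: num_real.
move=> M ltM z; rewrite /= in_itv/= => /andP[z0 _]; rewrite (le_trans _ (ltW ltM))//.
rewrite (le_trans (ler_normD _ _))// lerD2r.
by have /andP[? ?] := Fdist_bounds e z0; rewrite ger0_norm; lra.
Qed.

Lemma MconstD e (c : R) : \int[leb]_(z in I01) (1 - Fdist t e z + c) = Mconst t e + c.
Proof.
have i1 := integrable_1BFdist e 0.
have ic : leb.-integrable I01 (EFin \o (cst c : R -> R)).
  by apply: (@bounded_integrable_unit _ _ `|c|) => //.
have E : (fun z => 1 - Fdist t e z + 0) = (fun z => 1 - Fdist t e z).
  by apply/funext => z; rewrite addr0.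
rewrite E in i1; rewrite RintegralD//.
by rewrite (Rintegral_cst_unit c).
Qed.

Lemma le_MconstD e e' (c : R) :
  (forall z, 0 <= z -> Fdist t e' z <= Fdist t e z + c) -> Mconst t e <= Mconst t e' + c.
Proof.
move=> FF; rewrite -MconstD -[leLHS]addr0 -MconstD.
apply: le_Rintegral => //; try exact: integrable_1BFdist.
move=> z; rewrite /= in_itv/= => /andP[z0 _].
by have := FF _ z0; lra.
Qed.

Lemma Mconst_homo e e' : (forall k, e k -> e' k) -> Mconst t e' <= Mconst t e.
Proof.
move=> ee'; rewrite -[leRHS]addr0; apply: le_MconstD => z z0.
by rewrite addr0; exact: Fdist_homo.
Qed.

Lemma Mconst_agree e e' n : (forall k, (k < n)%N -> e k = e' k) ->
  Mconst t e <= Mconst t e' + t n.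
Proof.
move=> ee'; apply: le_MconstD => z z0; apply: Fdist_agree => // k kn.
by rewrite ee'.
Qed.

(** The first digit alone gives strictness: for [z] below [a 0] its term is [z] under constant 1 and
    at most [t 1 * z] under constant 0. *)
Lemma Mconst_const_lt : Mconst t (const_seq true) < Mconst t (const_seq false).
Proof.
have t0 : t 0%N = 1 by case: ht.
have a0E : a 0 = 1 - t 1%N by rewrite /gap t0.
(* All of cell [k] lies below [a 0]; there the gain [z * a 0] is at least [d], because [z] exceeds
   [t k.+1]. *)
have [k tk] := partition_seq_small ht (a_gt0 0).
pose A := cell t (Some k).
pose d := t k.+1 * a 0.
have d0 : 0 < d by rewrite mulr_gt0.
have mA : measurable A by exact: measurable_cell.
have tk_le1 : t k <= 1 by [].
have F_le z : 0 <= z ->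
    Fdist t (const_seq false) z <= Fdist t (const_seq true) z + - (d * \1_A z).
  move=> z0; apply: le_FdistD => // -[//|n] _.
  rewrite !big_nat_recl// addrAC lerD//; last first.
    by apply: ler_sum => i _; exact: min_le_Fdist_term.
  rewrite indicE; case: (boolP (z \in A)) => [/set_mem|_]; last first.
    by rewrite mulr0 subr0; exact: min_le_Fdist_term.
  rewrite /A /= in_itv/= => /andP[kz zk]; rewrite mulr1.
  rewrite t0 mul1r (min_r (ltW (le_lt_trans zk tk))) ge_min; apply/orP; right.
  by rewrite subn0 /d a0E; have := a_gt0 0; rewrite a0E; nra.
have iA : leb.-integrable I01 (EFin \o (fun z => d * \1_A z)).
  apply: (@bounded_integrable_unit _ _ d).
    by apply: measurable_funM => //; exact: measurable_indic.
  move=> z; rewrite normrM (ger0_norm (ltW d0)) indicE.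
  by case: (_ \in _); rewrite ?normr1 ?normr0 ?mulr1 ?mulr0// ltW.
have i1 := integrable_1BFdist (const_seq true) 0.
have E e : (fun z => 1 - Fdist t e z + 0) = (fun z => 1 - Fdist t e z).
  by apply/funext => z; rewrite addr0.
rewrite E in i1.
apply: (@lt_le_trans _ _ (Mconst t (const_seq true) + d * umeas A)).
  by rewrite ltrDl mulr_gt0// (umeas_cell ht).
have -> : Mconst t (const_seq true) + d * umeas A =
    \int[leb]_(z in I01) (1 - Fdist t (const_seq true) z + d * \1_A z).
  rewrite RintegralD// -Rintegral_indic_unit// RintegralZl//.
  apply: (@bounded_integrable_unit _ _ 1); first exact: measurable_indic.
  by move=> z; rewrite indicE; case: (_ \in _); rewrite ?normr1 ?normr0.
apply: le_Rintegral => //.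
- exact: (integrableD _ i1 iA).
- by rewrite -E; exact: integrable_1BFdist.
- move=> z; rewrite /= in_itv/= => /andP[z0 _].
  by have := F_le _ z0; lra.
Qed.

(** Words are encoded as prefixes of infinite sequences, which avoids tuples of varying length in
    the compactness argument. *)
Definition cut_seq (c : bool) n e : nat -> bool := fun i => if (i < n)%N then e i else c.

Lemma cut_seq_agree c n e e' : (forall k, (k < n)%N -> e k = e' k) ->
  cut_seq c n e = cut_seq c n e'.
Proof. by move=> ee'; apply/funext => i; rewrite /cut_seq; case: ifP => // /ee'. Qed.

Definition in_cylinder_hull n e x :=
  Mconst t (cut_seq true n e) <= x <= Mconst t (cut_seq false n e).

(** The intervals nest as the prefix grows, because the mean is antitone in the signs. *)
Lemma in_cylinder_hullW m n e x : (m <= n)%N ->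
  in_cylinder_hull n e x -> in_cylinder_hull m e x.
Proof.
move=> mn /andP[lo hi]; apply/andP; split.
  apply: le_trans lo; apply: Mconst_homo => k; rewrite /cut_seq.
  by case: (ltnP k m) => // km; rewrite (leq_trans km mn).
apply: (le_trans hi); apply: Mconst_homo => k; rewrite /cut_seq.
by case: (ltnP k m) => // km; rewrite (leq_trans km mn).
Qed.

(* Koenig's lemma: a prefix extendable to arbitrary lengths has a one-letter
   extension with the same property. *)
Lemma in_all_hulls x : (forall n, exists e, in_cylinder_hull n e x) ->
  exists e, forall n, in_cylinder_hull n e x.
Proof.
move=> Hx.
pose agree n e e' := forall k, (k < n)%N -> e k = e' k.
pose Q n e := forall N, (n <= N)%N -> exists e', agree n e e' /\ in_cylinder_hull N e' x.
pose upd n (c : bool) e := fun i : nat => if i == n then c else e i.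
have step n e : Q n e -> exists c, Q n.+1 (upd n c e).
  move=> Qe; apply: contrapT => /forallNP nQ.
  have [N0 /not_implyP[nN0 H0]] := iffRL (existsNP _) (nQ false).
  have [N1 /not_implyP[nN1 H1]] := iffRL (existsNP _) (nQ true).
  (* If both letters failed, at lengths [N0] and [N1], an extension of the larger length would
     contradict the failure of its own letter at [n]. *)
  have [e' [ee' He']] := Qe (maxn N0 N1) (leq_trans (ltnW nN0) (leq_maxl _ _)).
  have ag : agree n.+1 (upd n (e' n) e) e'.
    move=> k; rewrite ltnS /upd leq_eqVlt => /predU1P[->|kn]; first by rewrite eqxx.
    by rewrite ltn_eqF// ee'.
  case: (e' n) ag => ag.
    by apply: H1; exists e'; split => //; exact: in_cylinder_hullW (leq_maxr _ _) He'.
  by apply: H0; exists e'; split => //; exact: in_cylinder_hullW (leq_maxl _ _) He'.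
pose nxt n e := `[< Q n.+1 (upd n true e) >].
pose f := fix f n : nat -> bool := if n is m.+1 then upd m (nxt m (f m)) (f m) else xpred0.
have Qf n : Q n (f n).
  elim: n => [|n IH]; first by move=> N _; have [e' ?] := Hx N; exists e'; split.
  rewrite /= /nxt; case: asboolP => // nQ.
  by have [[]] := step _ _ IH.
(* Diagonal sequence: [f i.+1] already fixes the letter at [i], and later stages keep it. *)
pose e i := f i.+1 i.
have fe n : agree n e (f n).
  elim: n => // n IH k; rewrite ltnS leq_eqVlt => /predU1P[->//|kn].
  by rewrite IH// /= /upd ltn_eqF.
exists e => n; have [e' [ee' He']] := Qf n n (leqnn n).
have ag : agree n e e' by move=> k kn; rewrite (fe n k kn) ee'.
by rewrite /in_cylinder_hull !(cut_seq_agree _ ag).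
Qed.

(** Both numbers lie in the interval of the length-[n] prefix, whose length is at most [t n]. *)
Lemma Mconst_of_hulls e x : (forall n, in_cylinder_hull n e x) -> Mconst t e = x.
Proof.
move=> H; apply/eqP; rewrite -subr_eq0 -normr_le0 leNgt; apply/negP.
move=> /(partition_seq_small ht)[n]; apply/negP; rewrite -leNgt.
have /andP[lo hi] := H n.
have lo' : Mconst t (cut_seq true n e) <= Mconst t e.
  by apply: Mconst_homo => k; rewrite /cut_seq; case: ifP.
have hi' : Mconst t e <= Mconst t (cut_seq false n e).
  by apply: Mconst_homo => k; rewrite /cut_seq; case: ifP.
have h : Mconst t (cut_seq false n e) <= Mconst t (cut_seq true n e) + t n.
  by apply: Mconst_agree => k kn; rewrite /cut_seq kn.
by rewrite ler_norml; apply/andP; split; lra.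
Qed.

Lemma cat_wordE c n (w : n.-tuple bool) :
  cat_word w (const_seq c) = cut_seq c n (nth false w).
Proof. by apply/funext => i. Qed.

Lemma Mconst_set : [set Mconst t e | e in [set: nat -> bool]] =
  \bigcap_(n in [set: nat]) \bigcup_(w in [set: n.-tuple bool])
    `[Mconst t (cat_word w (const_seq true)),
      Mconst t (cat_word w (const_seq false))]%classic.
Proof.
apply/seteqP; split => x.
  move=> [e _ <-] n _; exists (Tuple (introT eqP (size_mkseq e n))) => //=.
  rewrite in_itv/= !cat_wordE /=.
  have ag k : (k < n)%N -> nth false (mkseq e n) k = e k by move=> ?; rewrite nth_mkseq.
  rewrite !(cut_seq_agree _ ag).
  by apply/andP; split; apply: Mconst_homo => k; rewrite /cut_seq; case: ifP.
move=> H; have [|e He] := @in_all_hulls x.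
  move=> n; have [w _] := H n I; rewrite /= in_itv/= !cat_wordE => wx.
  by exists (nth false w).
by exists e => //; exact: Mconst_of_hulls.
Qed.

End MeanValue.

Theorem theorem1p2 (R : realType) (t : nat -> R) (ht : is_partition_seq t) :
  (forall (e : nat -> bool) (z : R), 0 < z <= 1 ->
     {ae lebesgue_measure, forall x : R, 0 <= x <= 1 ->
        (theta_count t e z N x)%:R / N%:R @[N --> \oo] --> Fdist t e z}) /\
  Mconst t (const_seq true) < Mconst t (const_seq false) /\
  [set Mconst t e | e in [set: nat -> bool]] =
    \bigcap_(n in [set: nat]) \bigcup_(w in [set: n.-tuple bool])
      `[Mconst t (cat_word w (const_seq true)),
        Mconst t (cat_word w (const_seq false))]%classic.
Proof.
split; last by split; [exact: Mconst_const_lt|exact: Mconst_set].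
by move=> e z /andP[z0 _]; exact: ae_cvg_theta_count.
Qed.
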